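(* Let $S$ be an Artinian local ring, let $A=S[X_1,\ldots,X_r]$ where for $1\le i\le r$, $X_i=\{X_i(0),\ldots,X_i(s_i)\}$ is a set of indeterminates of degree $e_i\in\mathbb{N}^r$, let $I\subseteq A$ be a multi-homogeneous ideal, and let $R=A/I$. Let $N(t_1,\ldots,t_r)\in\mathbb{Z}[t_1,\ldots,t_r]$ be a polynomial such that the Hilbert series of $R$ satisfies $$\sum_{\underline{u}\in\mathbb{N}^r}\lambda(R_{\underline{u}})\,t_1^{u_1}\cdots t_r^{u_r} = \frac{N(t_1,\ldots,t_r)}{(1-t_1)^{s_1+1}\cdots(1-t_r)^{s_r+1}}.$$ Write the Hilbert polynomial of $R$ as $$P(\underline{u},R)=\sum_{\alpha=\underline{0}}^{\underline{s}} c_\alpha \binom{u_1+\alpha_1}{\alpha_1}\cdots\binom{u_r+\alpha_r}{\alpha_r}.$$ Then $$c_\alpha = \frac{(-1)^{|\underline{s}-\alpha|}}{(s_1-\alpha_1)!\cdots(s_r-\alpha_r)!}\cdot \left.\frac{\partial^{|\underline{s}-\alpha|}N}{\partial t_1^{s_1-\alpha_1}\cdots\partial t_r^{s_r-\alpha_r}}\right|_{(t_1,\ldots,t_r)=(1,\ldots,1)}.$$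
   Context: Here $\mathbb{N}=\{0,1,2,\ldots\}$, $e_i$ is the $i$-th standard unit vector of $\mathbb{N}^r$, $\underline{s}=(s_1,\ldots,s_r)$ with each $s_i\ge 0$, and $|\beta|=\beta_1+\cdots+\beta_r$ for $\beta\in\mathbb{N}^r$. The sum $\sum_{\alpha=\underline{0}}^{\underline{s}}$ runs over all $\alpha=(\alpha_1,\ldots,\alpha_r)\in\mathbb{N}^r$ with $0\le\alpha_i\le s_i$ for all $i$. The ring $A$ is $\mathbb{N}^r$-graded, $A=\bigoplus_{\underline{u}\in\mathbb{N}^r}A_{\underline{u}}$, where $A_{\underline{u}}$ is the $S$-module generated by the monomials $P_1\cdots P_r$ with $P_i$ a monomial of degree $u_i$ in the variables $X_i$. Elements of $A_{\underline{u}}$ are called multi-homogeneous of degree $\underline{u}$, and an ideal generated by multi-homogeneous elements is called multi-homogeneous. The quotient $R=A/I$ is $\mathbb{N}^r$-graded with $R_{\underline{u}}=A_{\underline{u}}/I_{\underline{u}}$, and $\lambda$ denotes length as an $S$-module. A polynomial $N\in\mathbb{Z}[t_1,\ldots,t_r]$ expressing the Hilbert series in the stated form always exists (the rational function need not be reduced). The Hilbert polynomial $P(\underline{u},R)$ is the unique polynomial in $u_1,\ldots,u_r$ with rational coefficients such that $P(\underline{u},R)=\lambda(R_{\underline{u}})$ whenever all $u_i$ are sufficiently large; it can be written uniquely in the stated form. *)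

(* Defs.v *)
From HB Require Import structures.
From mathcomp Require Import all_boot all_order all_algebra.
From mathcomp Require Import mpoly.
From Stdlib Require Import ClassicalEpsilon.

Set Implicit Arguments.
Unset Strict Implicit.
Unset Printing Implicit Defensive.

Import GRing.Theory.

Local Open Scope ring_scope.
Local Open Scope quotient_scope.

(* Ideals and submodules are boolean predicates, as everywhere in MathComp;
   since classical logic is assumed, this is no restriction. Contrary to
   [idealr], [idealType] includes the unit ideal. *)

Definition mul_absorbing (A : comNzRingType) (I : {pred A}) : Prop :=
  forall a, {in I, forall x, a * x \in I}.

HB.mixin Record isMulAbsorbing (A : comNzRingType) (I : A -> bool) := {
  idealMl : mul_absorbing I
}.

#[short(type="idealType")]
HB.structure Definition Ideal (A : comNzRingType) :=
  {I of GRing.ZmodClosed A I & isMulAbsorbing A I}.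

Definition maximal_ideal (A : comNzRingType) (M : idealType A) : Prop :=
  1 \notin (M : {pred A}) /\
  forall J : idealType A, {subset M <= J} -> 1 \notin (J : {pred A}) -> J =i M.

Definition local_ring (A : comNzRingType) : Prop :=
  exists2 M : idealType A, maximal_ideal M &
    forall M' : idealType A, maximal_ideal M' -> M' =i M.

Definition artinian_ring (A : comNzRingType) : Prop :=
  forall J : nat -> idealType A, (forall n, {subset J n.+1 <= J n}) ->
    exists n, forall k, (n <= k)%N -> J k =i J n.

Section Length.
Variables (S : comNzRingType) (V : lmodType S).

(* N 0 < ... < N n is a strict chain of S-submodules of V contained in M. *)
Definition submod_chain (M : V -> Prop) (n : nat) (N : nat -> submodClosed V) :
    Prop :=
  (forall k, (k < n)%N ->
     {subset N k <= N k.+1} /\ exists2 x, x \in N k.+1 & x \notin N k) /\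
  (forall x, x \in N n -> M x).

Definition is_length (M : V -> Prop) (n : nat) : Prop :=
  (exists N, submod_chain M n N) /\
  (forall m N, submod_chain M m N -> (m <= n)%N).

(* Unspecified when M has infinite length; below it is only applied to finitely
   generated modules over an Artinian ring, which have finite length. *)
Definition slength (M : V -> Prop) : nat :=
  epsilon (inhabits 0%N) (is_length M).

End Length.

Section QuotientAlgebra.
Variables (S : comNzRingType) (A : comAlgType S) (I : idealType A).

Definition quot_alg : Type := {ideal_quot I}.

HB.instance Definition _ := GRing.Zmodule.copy quot_alg {ideal_quot I}.

Definition quot_proj (p : A) : quot_alg := \pi_({ideal_quot I}) p.

Fact quot_projK (x : quot_alg) : quot_proj (repr (x : {ideal_quot I})) = x.
Proof. exact: reprK. Qed.

Fact quot_projD : {morph quot_proj : p q / p + q}.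
Proof. exact: Quotient.pi_add. Qed.

Definition quot_scale (a : S) (x : quot_alg) : quot_alg :=
  quot_proj (a *: repr (x : {ideal_quot I})).

Fact quot_projZ (a : S) (p : A) : quot_scale a (quot_proj p) = quot_proj (a *: p).
Proof.
apply/eqP; rewrite /quot_scale -Quotient.idealrBE -scalerBr -mulr_algl.
apply: (@idealMl _ I); rewrite Quotient.idealrBE; apply/eqP; exact: reprK.
Qed.

Fact quot_scaleA a b x : quot_scale a (quot_scale b x) = quot_scale (a * b) x.
Proof. by rewrite -(quot_projK x) !quot_projZ scalerA. Qed.

Fact quot_scale1 : left_id 1 quot_scale.
Proof. by move=> x; rewrite -(quot_projK x) quot_projZ scale1r. Qed.

Fact quot_scaleDr : right_distributive quot_scale +%R.
Proof.
move=> a x y; rewrite -(quot_projK x) -(quot_projK y) -quot_projD.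
by rewrite !quot_projZ scalerDr quot_projD.
Qed.

Fact quot_scaleDl x : {morph quot_scale^~ x : a b / a + b}.
Proof.
by move=> a b; rewrite -(quot_projK x) !quot_projZ scalerDl quot_projD.
Qed.

HB.instance Definition _ := GRing.Zmodule_isLmodule.Build S quot_alg
  quot_scaleA quot_scale1 quot_scaleDr quot_scaleDl.

End QuotientAlgebra.

Section Multigraded.
Variables (S : comNzRingType) (r : nat) (s : 'X_{1..r}).

(* X_i(j), for i < r and 0 <= j <= s_i, is the pair (i, j); mpoly wants the
   variables to be numbered, which is done by enum_rank/enum_val. *)
Definition mvar : finType := {i : 'I_r & 'I_(s i).+1}.

Definition mring := {mpoly S[#|mvar|]}.

(* every variable X_i(j) has degree e_i = U_(i) *)
Definition multideg (m : 'X_{1..#|mvar|}) : 'X_{1..r} :=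
  (\sum_(k < #|mvar|) U_(tag (enum_val k)) *+ m k)%MM.

Definition multihomog (u : 'X_{1..r}) (p : mring) : bool :=
  all (fun m => multideg m == u) (msupp p).

Definition generated_by (I : idealType mring) (G : mring -> Prop) : Prop :=
  forall p, p \in I <->
    exists n (a g : 'I_n -> mring),
      (forall k, G (g k)) /\ p = \sum_(k < n) a k * g k.

Definition multihomog_ideal (I : idealType mring) : Prop :=
  exists G : mring -> Prop,
    (forall g, G g -> exists u, multihomog u g) /\ generated_by I G.

(* R_u = A_u / I_u, realised as the image of A_u in R = A / I *)
Definition quot_component (I : idealType mring) (u : 'X_{1..r}) :
    quot_alg I -> Prop :=
  fun x => exists2 p, multihomog u p & x = quot_proj I p.

Definition hilbert_function (I : idealType mring) (u : 'X_{1..r}) : nat :=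
  slength (@quot_component I u).

Definition is_hilbert_polynomial (I : idealType mring) (P : {mpoly rat[r]}) :
    Prop :=
  exists n0 : nat, forall u : 'X_{1..r}, (forall i, (n0 <= u i)%N) ->
    P.@[fun i => (u i)%:R] = (hilbert_function I u)%:R.

End Multigraded.

Section Series.
Variable (r : nat).

(* formal power series in t_1, ..., t_r, given by their coefficients *)
Definition mseries := 'X_{1..r} -> int.

Definition mseries_of_mpoly (p : {mpoly int[r]}) : mseries := fun m => p@_m.

(* Cauchy product; the bound on the degree only makes the sum finite, compare
   [mcoeffM]. *)
Definition mseries_mul (F G : mseries) : mseries := fun m =>
  \sum_(k : 'X_{1..r < (mdeg m).+1, (mdeg m).+1} | m == (k.1 + k.2)%MM)
    F k.1 * G k.2.

(* F = N / D in the ring of power series; meant for D with constant term 1,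
   which is invertible there. *)
Definition is_mseries_frac (F : mseries) (N D : {mpoly int[r]}) : Prop :=
  mseries_mul (mseries_of_mpoly D) F =1 mseries_of_mpoly N.

(* the polynomial binomial(u_i + a, a) = (u_i + 1) ... (u_i + a) / a! *)
Definition binom_mpoly (i : 'I_r) (a : nat) : {mpoly rat[r]} :=
  (a`!%:R)^-1 *: \prod_(k < a) ('X_i + k.+1%:R).

End Series.

Definition hilbert_series (S : comNzRingType) (r : nat) (s : 'X_{1..r})
    (I : idealType (mring S s)) : mseries r :=
  fun u => (hilbert_function I u)%:Z.

(* Main.v *)
Require Import Defs.
From mathcomp Require Import all_boot all_order all_algebra.
From mathcomp Require Import mpoly ring.

Set Implicit Arguments.
Unset Strict Implicit.
Unset Printing Implicit Defensive.

Import GRing.Theory.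

Local Open Scope ring_scope.

(** Why the formula holds. Lengths enter only through the numbers F u, the
    coefficients of the Hilbert series; the formula is about any power series
    F = N / prod_i (1 - t_i)^(s_i + 1) whose coefficients agree, for large u,
    with a polynomial P = sum_alpha c_alpha prod_i B_(alpha_i)(u_i), where
    B_b(x) is the polynomial binomial(x + b, b).

    Expanding 1 / (1 - t)^(b + 1) = sum_j binomial(j + b, b) t^j gives
    F u = sum_m N_m prod_i B_(s_i)(u_i - m_i) once u dominates all exponents of
    N ([mseries_frac_coeff]). Two polynomials that agree on a translated
    orthant of N^r are equal everywhere ([meval_eq_on_orthant]), so
    P(x) = sum_m N_m prod_i B_(s_i)(x_i - m_i) for all rational x
    ([eventual_polynomial_of_frac]), although F u itself follows this formula
    only for large u.

    This allows evaluation at negative integers, where reciprocity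
    B_b(-1 - n) = (-1)^b binomial(n, b) holds ([binom_fun_neg]). The functional
    that extracts c_alpha is the iterated backward difference of order alpha,
    taken at (-1, ..., -1) ([diff_at_minus1]). By reciprocity and one binomial
    identity ([alternating_binomial_sum]) it sends prod_i B_(beta_i)(x_i - m_i)
    to prod_i (-1)^(alpha_i + beta_i) binomial(m_i, beta_i - alpha_i), read as 0
    unless alpha <= beta ([diff_at_minus1_binom]). With m = 0 this is the
    Kronecker delta of alpha and beta, so the functional takes the value c_alpha
    on P. With beta = s, summed against N_m, it is
    (-1)^|s - alpha| sum_m N_m prod_i binomial(m_i, s_i - alpha_i), and the sum
    is the derivative of N of order s - alpha at (1, ..., 1), divided by
    prod_i (s_i - alpha_i)!. *)

(** * Truncated inversion of a power of 1 - x *)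

(** Multiplication by 1 - x takes differences of coefficients, and Pascal's rule
    says what these are; the last term is the error of cutting the series off. *)
Lemma mulr_one_sub_binomial_sum (R : comNzRingType) (x : R) s n :
  (1 - x) * (\sum_(j < n) 'C(j + s.+1, s.+1)%:R * x ^+ j)
  = \sum_(j < n) 'C(j + s, s)%:R * x ^+ j - 'C(n + s, s.+1)%:R * x ^+ n.
Proof.
elim: n => [|n IH].
  by rewrite !big_ord0 add0n bin_small // mul0r mulr0 subr0.
rewrite !big_ord_recr /= mulrDr IH addSn addnS !binS !natrD exprS.
by ring.
Qed.

(** The binomial series inverts (1 - x)^(s + 1) modulo x^n. Being stated for an
    element of a ring, it applies directly to x = 'X_i. *)
Lemma one_sub_expr_inv_trunc (R : comNzRingType) (x : R) s n :
  exists y,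
    (1 - x) ^+ s.+1 * (\sum_(j < n) 'C(j + s, s)%:R * x ^+ j) = 1 + x ^+ n * y.
Proof.
elim: s => [|s [y IH]].
  exists (-1); rewrite expr1 mulrN1 -opprB mulNr.
  under eq_bigr => j _ do rewrite bin0 mul1r.
  by rewrite -subrX1 opprB.
exists (y - (1 - x) ^+ s.+1 * 'C(n + s, s.+1)%:R).
rewrite exprSr -mulrA mulr_one_sub_binomial_sum mulrBr IH.
by ring.
Qed.

(** * Power series modulo high exponents *)

Section Box.
Variables (n : nat) (R : comNzRingType).
Implicit Types (u m : 'X_{1..n}) (p q : {mpoly R[n]}).

(** Power series are computed with as polynomials up to this congruence, which is
    compatible with products because the divisors of a monomial below u are
    below u. *)
Definition eq_upto u p q := forall m, (m <= u)%MM -> p@_m = q@_m.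

Lemma mnm_le_addends m a b : m = (a + b)%MM -> (a <= m)%MM /\ (b <= m)%MM.
Proof. by move->; rewrite lem_addr lem_addl. Qed.

Lemma eq_upto_mul u p p' q q' :
  eq_upto u p p' -> eq_upto u q q' -> eq_upto u (p * q) (p' * q').
Proof.
move=> hp hq m le_mu; rewrite !mcoeffM; apply: eq_bigr => k /eqP/mnm_le_addends[le1 le2].
by rewrite hp ?hq //; apply: lepm_trans le_mu.
Qed.

Lemma eq_upto_prod u (f g : 'I_n -> {mpoly R[n]}) :
  (forall i, eq_upto u (f i) (g i)) -> eq_upto u (\prod_i f i) (\prod_i g i).
Proof. by move=> fg; elim/big_ind2: _ => // *; apply: eq_upto_mul. Qed.

Lemma eq_upto_Xn u i k q : (u i < k)%N -> eq_upto u (1 + 'X_i ^+ k * q) 1.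
Proof.
move=> lt_uk m /mnm_lepP/(_ i) le_mu; rewrite mcoeffD mcoeffM big1 ?addr0 //.
move=> j /eqP/mnm_le_addends[/mnm_lepP/(_ i) le_jm _].
rewrite mpolyXn mcoeffX; case: eqP => [Dj|]; last by rewrite mul0r.
have := leq_ltn_trans (leq_trans le_jm le_mu) lt_uk.
by rewrite -Dj mulmnE mnm1E eqxx mul1n ltnn.
Qed.

(** The cut is by total degree because the exponents of bounded degree form a
    finite type; it keeps every exponent below u. *)
Definition trunc_series (F : 'X_{1..n} -> R) u : {mpoly R[n]} :=
  \sum_(m : 'X_{1..n < (mdeg u).+1}) F m *: 'X_[m].

Lemma mnm_le_mdeg m i : (m i <= mdeg m)%N.
Proof. by rewrite mdegE (bigD1 i) //= leq_addr. Qed.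

Lemma mdeg_le m u : (m <= u)%MM -> (mdeg m <= mdeg u)%N.
Proof. by move=> /submK <-; rewrite mdegD leq_addl. Qed.

Lemma mcoeff_trunc_series F u m : (m <= u)%MM -> (trunc_series F u)@_m = F m.
Proof.
move=> /mdeg_le; rewrite -ltnS => lt_mu; rewrite raddf_sum /= (bigD1 (BMultinom lt_mu)) //=.
rewrite mcoeffZ mcoeffX eqxx mulr1 big1 ?addr0 // => k ne_k.
rewrite mcoeffZ mcoeffX; case: eqP => [Dk|]; last by rewrite mulr0.
by rewrite -val_eqE /= Dk eqxx in ne_k.
Qed.

Definition binomial_series_trunc (s u : 'X_{1..n}) : {mpoly R[n]} :=
  \prod_(i < n) \sum_(j < (mdeg u).+1) 'C(j + s i, s i)%:R * 'X_i ^+ j.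

(** Each exponent m arises from exactly one choice f0 of a term in every
    factor. *)
Lemma mcoeff_binomial_series_trunc s u m : (m <= u)%MM ->
  (binomial_series_trunc s u)@_m = \prod_(i < n) 'C(m i + s i, s i)%:R.
Proof.
move=> le_mu; rewrite /binomial_series_trunc bigA_distr_bigA raddf_sum /=.
have lt_m i : (m i < (mdeg u).+1)%N.
  by rewrite ltnS (leq_trans _ (mdeg_le le_mu)) // mnm_le_mdeg.
pose f0 := [ffun i => Ordinal (lt_m i)].
have Df (f : {ffun 'I_n -> 'I_(mdeg u).+1}) :
  (\prod_(i < n) ('C(f i + s i, s i)%:R * 'X_i ^+ f i) : {mpoly R[n]})@_m
  = (\prod_(i < n) 'C(f i + s i, s i)%:R) * ([multinom (f i : nat) | i < n] == m)%:R.
  rewrite big_split /= -natr_prod mulr_natl mcoeffMn.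
  rewrite -(@eq_bigr _ _ _ _ _ _ (fun i => 'X_i ^+ [multinom (f i : nat) | i < n] i)).
    by rewrite -mpolyXE_id mcoeffX -natr_prod mulr_natl.
  by move=> i _; rewrite mnmE.
rewrite (bigD1 f0) //= [X in _ + X]big1 ?addr0 => [|f ne_f].
  rewrite Df (_ : _ == m) ?mulr1; last by apply/eqP/mnmP => i; rewrite mnmE ffunE.
  by apply: eq_bigr => i _; rewrite ffunE.
rewrite Df; case: eqP => [Dm|]; last by rewrite mulr0.
case/eqP: ne_f; apply/ffunP => i; apply: val_inj; rewrite ffunE /=.
by rewrite -Dm mnmE.
Qed.

Lemma binomial_series_truncP (s u : 'X_{1..n}) :
  eq_upto u ((\prod_(i < n) (1 - 'X_i) ^+ (s i).+1) * binomial_series_trunc s u) 1.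
Proof.
have D1 : \prod_(i < n) 1 = 1 :> {mpoly R[n]} by rewrite big1.
rewrite -big_split /= -[X in eq_upto _ _ X]D1.
apply: eq_upto_prod => i.
have [y ->] := one_sub_expr_inv_trunc ('X_i : {mpoly R[n]}) (s i) (mdeg u).+1.
by apply: eq_upto_Xn; rewrite ltnS mnm_le_mdeg.
Qed.
End Box.

(** Multiplying N = D F by the truncated inverse E of D gives F = N E up to u.
    The hypothesis on u makes u - m an honest difference for every monomial of N;
    without it those terms would have to be dropped. *)
Lemma mseries_frac_coeff r (F : mseries r) (N : {mpoly int[r]}) (s u : 'X_{1..r}) :
  is_mseries_frac F N (\prod_(i < r) (1 - 'X_i) ^+ (s i).+1) ->
  (forall m, m \in msupp N -> (m <= u)%MM) ->
  F u = \sum_(m <- msupp N) N@_m * \prod_(i < r) 'C(u i - m i + s i, s i)%:R.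
Proof.
set D := \prod_(i < r) _ => hN le_u.
have DF : eq_upto u (D * trunc_series F u) N.
  move=> m le_mu; rewrite -[N@_m]hN mcoeffM; apply: eq_bigr => k /eqP/mnm_le_addends[_ le2].
  by rewrite mcoeff_trunc_series //; apply: lepm_trans le_mu.
have E_refl : eq_upto u (binomial_series_trunc int s u) (binomial_series_trunc int s u) by [].
have F_refl : eq_upto u (trunc_series F u) (trunc_series F u) by [].
rewrite -(mcoeff_trunc_series F (lepm_refl u)) -[trunc_series F u]mul1r.
rewrite -(eq_upto_mul (@binomial_series_truncP _ _ s u) F_refl) ?lepm_refl //.
rewrite mulrAC (eq_upto_mul DF E_refl) ?lepm_refl //.
rewrite [N in LHS]mpolyE mulr_suml raddf_sum /=; apply: eq_big_seq => m m_N.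
rewrite -scalerAl mcoeffZ; congr (_ * _).
rewrite mulrC -[X in _@_X](submK (le_u m m_N)) addmC mcoeffMX mcoeff_binomial_series_trunc ?lem_subr //.
by apply: eq_bigr => i _; rewrite mnmBE.
Qed.

(** * Binomial polynomials and reciprocity *)

(** The polynomial binomial(x + b, b) as a function. *)
Definition binom_fun (b : nat) (x : rat) : rat :=
  (b`!%:R)^-1 * \prod_(k < b) (x + k.+1%:R).

Lemma meval_binom_mpoly r (i : 'I_r) b (v : 'I_r -> rat) :
  (binom_mpoly i b).@[v] = binom_fun b (v i).
Proof.
rewrite /binom_mpoly mevalZ rmorph_prod /=; congr (_ * _).
by apply: eq_bigr => k _; rewrite mevalD mevalXU -[k.+1%:R in LHS]mpolyC_nat mevalC.
Qed.

Lemma fact_rat_neq0 k : k`!%:R != 0 :> rat.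
Proof. by rewrite Num.Theory.pnatr_eq0 -lt0n fact_gt0. Qed.

Lemma binom_fun_nat b n : binom_fun b n%:R = 'C(n + b, b)%:R.
Proof.
apply: (mulfI (fact_rat_neq0 b)); rewrite /binom_fun mulrA divff ?fact_rat_neq0 // mul1r.
rewrite -natrM mulnC bin_ffact ffact_prod natr_prod (reindex_inj rev_ord_inj) /=.
apply: eq_bigr => k _; rewrite -natrD; congr (_%:R).
by rewrite subnSK // addnBA // ltnW.
Qed.

(** Reciprocity. If n < b, one factor of the product vanishes, in accordance with
    binomial(n, b) = 0. *)
Lemma binom_fun_neg b n : binom_fun b (- 1 - n%:R) = (-1) ^+ b * 'C(n, b)%:R.
Proof.
apply: (mulfI (fact_rat_neq0 b)); rewrite /binom_fun mulrA divff ?fact_rat_neq0 // mul1r.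
rewrite mulrCA -natrM [(b`! * _)%N]mulnC bin_ffact.
have [lt_nb|le_bn] := ltnP n b.
  rewrite ffact_small // mulr0 (bigD1 (Ordinal lt_nb)) //= -natr1.
  by ring.
rewrite ffact_prod natr_prod -[in (-1) ^+ b](card_ord b) -prodr_const -big_split /=.
apply: eq_bigr => k _; rewrite natrB ?(leq_trans (ltnW (ltn_ord k))) // -natr1.
by ring.
Qed.

(** The left-hand side is, up to sign, the a-th difference of binomial(x, b) at
    x = m, and each difference lowers b by one. Summing up to any K > a makes
    the index range independent of a, which the multivariate sum needs. *)
Lemma alternating_binomial_sum K a b m : (a < K)%N ->
  \sum_(j < K) (-1) ^+ j * 'C(a, j)%:R * 'C(m + j, b)%:R
  = (-1) ^+ a * ((a <= b)%N * 'C(m, b - a))%:R :> rat.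
Proof.
elim: a K m => [|a IH] [|K] m //= lt_aK.
  rewrite big_ord_recl big1 ?addr0 => [|j _]; last by rewrite bin0n /= mulr0 mul0r.
  by rewrite /= subn0 addn0 expr0 bin0 mul1n !mul1r.
(* Pascal's rule in a splits the sum into those for m and for m + 1. *)
transitivity (\sum_(j < K.+1) (-1) ^+ j * 'C(a, j)%:R * 'C(m + j, b)%:R
   - \sum_(j < K) (-1) ^+ j * 'C(a, j)%:R * 'C(m.+1 + j, b)%:R :> rat).
  rewrite !big_ord_recl /= !bin0 -addrA -sumrB; congr (_ + _).
  by apply: eq_bigr => j _; rewrite /bump /= add1n binS natrD addnS exprS addSn; ring.
rewrite !IH //; last exact: leqW.
case: (ltngtP a b) => [lt_ab|lt_ba|->]; rewrite ?mul0n ?mulr0 ?subr0 //.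
  by rewrite !mul1n -(subnSK lt_ab) binS natrD exprS; ring.
by rewrite ?mul1n subnn !bin0 subrr ?mul0n ?mulr0.
Qed.

Lemma alternating_binom_fun_sum K a b m : (a < K)%N ->
  \sum_(j < K) (-1) ^+ j * 'C(a, j)%:R * binom_fun b (- 1 - j%:R - m%:R)
  = (-1) ^+ (a + b) * ((a <= b)%N * 'C(m, b - a))%:R.
Proof.
move=> lt_aK; rewrite exprD -mulrA mulrCA -(@alternating_binomial_sum K) // mulr_sumr.
apply: eq_bigr => j _; rewrite -addrA -opprD -natrD binom_fun_neg addnC; ring.
Qed.

(** * Polynomials that agree on an orthant *)

Lemma poly_eq0_injective (R : idomainType) (q : {poly R}) (a : nat -> R) :
  injective a -> (forall k, q.[a k] = 0) -> q = 0.
Proof.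
move=> a_inj q_a; apply/eqP; apply: contraTT isT => q_neq0.
have := @max_poly_roots R q [seq a k | k <- iota 0 (size q)] q_neq0.
rewrite size_map size_iota ltnn; apply.
  by apply/allP => _ /mapP[k _ ->]; apply/rootP.
by rewrite map_inj_uniq // iota_uniq.
Qed.

(** The coordinates are freed one at a time: with the others fixed, the value is
    a univariate polynomial with infinitely many roots. *)
Lemma meval_eq0_injective (R : idomainType) n (p : {mpoly R[n]}) (a : nat -> R) :
  injective a -> (forall v : 'I_n -> nat, p.@[fun i => a (v i)] = 0) ->
  forall x, p.@[x] = 0.
Proof.
move=> a_inj p_a x.
(* The first k coordinates are arbitrary, the others are values of a. *)
suffices p_mix k : forall v y,
    p.@[fun i : 'I_n => if (i < k)%N then y i else a (v i)] = 0.
  rewrite -(p_mix n (fun=> 0%N) x); apply: meval_eq => i.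
  by rewrite ltn_ord.
elim: k => [|k IH] v y.
  by rewrite -[RHS](p_a v).
pose q := mmap polyC (fun i : 'I_n => if i == k :> nat then 'X
   else (if (i < k)%N then y i else a (v i))%:P) p.
have q_eval t : q.[t] = p.@[fun i : 'I_n => if i == k :> nat then t
   else (if (i < k)%N then y i else a (v i))].
  rewrite /q /mmap mevalE horner_sum; apply: eq_bigr => m _.
  rewrite hornerM hornerC /mmap1 horner_prod; congr (_ * _).
  apply: eq_bigr => i _; rewrite horner_exp; congr (_ ^+ _).
  by case: ifP => _; rewrite ?hornerX ?hornerC.
have q0 : q = 0.
  apply: poly_eq0_injective a_inj _ => l; rewrite q_eval.
  rewrite -(IH (fun i => if i == k :> nat then l else v i) y).
  apply: meval_eq => i; case: ltngtP => //.
case: (ltnP k n) => [lt_kn|le_nk].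
  have := q_eval (y (Ordinal lt_kn)); rewrite q0 horner0 => ->.
  apply: meval_eq => i; rewrite ltnS; case: ltngtP => // Di.
  by congr y; apply: val_inj.
rewrite -(IH v y); apply: meval_eq => i.
by rewrite (leq_trans (ltn_ord i) le_nk) (leq_trans (ltn_ord i) (leqW le_nk)).
Qed.

Lemma meval_eq_on_orthant r (P Q : {mpoly rat[r]}) n0 :
  (forall u : 'X_{1..r}, (forall i, (n0 <= u i)%N) ->
     P.@[fun i => (u i)%:R] = Q.@[fun i => (u i)%:R]) ->
  forall x, P.@[x] = Q.@[x].
Proof.
move=> PQ x; apply/eqP; rewrite -subr_eq0 -mevalB; apply/eqP.
apply: (@meval_eq0_injective _ _ _ (fun k => (n0 + k)%:R)) => [k l|v].
  by move/eqP; rewrite Num.Theory.eqr_nat eqn_add2l => /eqP.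
have := PQ [multinom (n0 + v i)%N | i < r]; rewrite mevalB => PQv.
apply/eqP; rewrite subr_eq0; apply/eqP.
rewrite -!(@meval_eq _ _ (fun i => ([multinom (n0 + v i)%N | i < r] i)%:R)).
- by apply: PQv => i; rewrite mnmE leq_addr.
- by move=> i; rewrite mnmE.
- by move=> i; rewrite mnmE.
Qed.

(** * The difference functional *)

Section DifferenceFunctional.
Variable r : nat.
Implicit Types (alpha beta m : 'X_{1..r}) (g h : ('I_r -> rat) -> rat).

(** The backward difference of order alpha_i in each variable x_i, at the point
    (-1, ..., -1). Terms with j_i > alpha_i vanish; the common bound mdeg alpha
    lets one type of functions index the sum. *)
Definition diff_at_minus1 alpha g : rat :=
  \sum_(j : {ffun 'I_r -> 'I_(mdeg alpha).+1})
     (\prod_(i < r) ((-1) ^+ j i * 'C(alpha i, j i)%:R)) * g (fun i => - 1 - (j i)%:R).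

Lemma eq_diff_at_minus1 alpha g h :
  g =1 h -> diff_at_minus1 alpha g = diff_at_minus1 alpha h.
Proof. by move=> gh; apply: eq_bigr => j _; rewrite gh. Qed.

Lemma diff_at_minus1_sum alpha (T : Type) (l : seq T) (Q : pred T) (c : T -> rat)
    (g : T -> ('I_r -> rat) -> rat) :
  diff_at_minus1 alpha (fun x => \sum_(k <- l | Q k) c k * g k x)
  = \sum_(k <- l | Q k) c k * diff_at_minus1 alpha (g k).
Proof.
rewrite /diff_at_minus1; under eq_bigr => j _ do rewrite mulr_sumr.
rewrite exchange_big; apply: eq_bigr => k _ /=; rewrite mulr_sumr.
by apply: eq_bigr => j _; rewrite mulrCA.
Qed.

(** A product of functions of one variable each is differenced variable by
    variable. *)
Lemma diff_at_minus1_binom alpha beta m :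
  diff_at_minus1 alpha (fun x => \prod_(i < r) binom_fun (beta i) (x i - (m i)%:R))
  = \prod_(i < r)
      ((-1) ^+ (alpha i + beta i) *
       ((alpha i <= beta i)%N * 'C(m i, beta i - alpha i))%:R).
Proof.
rewrite /diff_at_minus1; under eq_bigr => j _ do rewrite -big_split /=.
rewrite -(bigA_distr_bigA (fun i (j : 'I_(mdeg alpha).+1) =>
  (-1) ^+ j * 'C(alpha i, j)%:R * binom_fun (beta i) (- 1 - j%:R - (m i)%:R))) /=.
apply: eq_bigr => i _; apply: alternating_binom_fun_sum.
by rewrite ltnS mnm_le_mdeg.
Qed.
End DifferenceFunctional.

(** * Coefficients of the Hilbert polynomial *)

Lemma meval1_mderivm (R : comNzRingType) n (p : {mpoly R[n]}) m :
  (p^`M[m]).@[fun=> 1] = \sum_(k <- msupp p) p@_k * (\prod_(i < n) (k i) ^_ (m i))%:R.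
Proof.
rewrite mderivmE raddf_sum /=; apply: eq_bigr => k _.
rewrite mevalZ mevalX [X in _ * X]big1 ?mulr1 // => i _; exact: expr1n.
Qed.

(** The values of F determine P for large u only, but P is then the same
    polynomial as the right-hand side. *)
Lemma eventual_polynomial_of_frac r (F : mseries r) (N : {mpoly int[r]}) (s : 'X_{1..r})
    (P : {mpoly rat[r]}) n0 :
  is_mseries_frac F N (\prod_(i < r) (1 - 'X_i) ^+ (s i).+1) ->
  (forall u : 'X_{1..r}, (forall i, (n0 <= u i)%N) ->
     P.@[fun i => (u i)%:R] = (F u)%:~R) ->
  forall x, P.@[x] = \sum_(m <- msupp N) (N@_m)%:~R *
    \prod_(i < r) binom_fun (s i) (x i - (m i)%:R).
Proof.
move=> hN hP x.
pose Q : {mpoly rat[r]} := \sum_(m <- msupp N) (N@_m)%:~R *: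
  \prod_(i < r) (binom_mpoly i (s i) \mPo [tuple 'X_j - (m j)%:R%:MP | j < r]).
have QE y : Q.@[y] = \sum_(m <- msupp N) (N@_m)%:~R *
    \prod_(i < r) binom_fun (s i) (y i - (m i)%:R).
  rewrite /Q raddf_sum /=; apply: eq_bigr => m _; rewrite mevalZ rmorph_prod /=.
  congr (_ * _); apply: eq_bigr => i _.
  by rewrite comp_mpoly_meval meval_binom_mpoly tnth_mktuple mevalB mevalXU mevalC.
rewrite -QE; move: x; apply: (@meval_eq_on_orthant _ _ _ (n0 + msize N)) => u le_u.
have le_mu m : m \in msupp N -> (m <= u)%MM.
  move=> m_N; apply/mnm_lepP => i; apply: leq_trans (leq_trans _ (le_u i)).
    exact: mnm_le_mdeg.
  by apply: leq_trans (leq_addl _ _); apply/ltnW/msize_mdeg_lt.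
rewrite QE hP => [|i]; last exact: leq_trans (leq_addr _ _) (le_u i).
rewrite (mseries_frac_coeff hN le_mu) rmorph_sum /=; apply: eq_big_seq => m m_N.
rewrite rmorphM rmorph_prod /=; congr (_ * _); apply: eq_bigr => i _.
by rewrite -natrB ?(mnm_lepP (le_mu m m_N)) // binom_fun_nat rmorph_nat.
Qed.

(** P has two expansions into products of binomial polynomials, one with the
    coefficients c and one with those of N; the difference functional of order
    alpha takes the value c alpha on the first and the derivative of N on the
    second. *)
Lemma binom_coefficient_of_frac r (F : mseries r) (N : {mpoly int[r]}) (s : 'X_{1..r})
    (P : {mpoly rat[r]}) n0 (c : 'X_{1..r} -> rat) (alpha : 'X_{1..r}) :
  is_mseries_frac F N (\prod_(i < r) (1 - 'X_i) ^+ (s i).+1) ->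
  (forall u : 'X_{1..r}, (forall i, (n0 <= u i)%N) ->
     P.@[fun i => (u i)%:R] = (F u)%:~R) ->
  P = \sum_(alpha : 'X_{1..r < (mdeg s).+1} | (alpha <= s)%MM)
        c alpha *: \prod_(i < r) binom_mpoly i (alpha i) ->
  (alpha <= s)%MM ->
  c alpha = (-1) ^+ mdeg (s - alpha)%MM
              / (\prod_(i < r) (s i - alpha i)%N`!)%:R
              * (N^`M[s - alpha]).@[fun=> 1]%:~R.
Proof.
move=> hN hP DP le_as; have P_N := eventual_polynomial_of_frac hN hP.
have P_c x : P.@[x] = \sum_(gamma : 'X_{1..r < (mdeg s).+1} | (gamma <= s)%MM)
    c gamma * \prod_(i < r) binom_fun (gamma i) (x i - (0%MM i)%:R).
  rewrite DP raddf_sum /=; apply: eq_bigr => gamma _; rewrite mevalZ rmorph_prod /=.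
  by congr (_ * _); apply: eq_bigr => i _; rewrite meval_binom_mpoly mnm0E subr0.
have := eq_diff_at_minus1 alpha (fun x => etrans (esym (P_c x)) (P_N x)).
rewrite !diff_at_minus1_sum.
under eq_bigr do rewrite diff_at_minus1_binom.
under [RHS]eq_bigr do rewrite diff_at_minus1_binom.
have lt_as : (mdeg alpha < (mdeg s).+1)%N by rewrite ltnS mdeg_le.
rewrite (bigD1 (BMultinom lt_as)) //= [X in _ + X]big1 ?addr0 => [|gamma /andP[_ ne_ga]].
  rewrite big1 ?mulr1 => [->|i _]; last first.
    by rewrite leqnn subnn bin0 mulr1 addnn -mul2n exprM sqrrN !expr1n.
  rewrite meval1_mderivm rmorph_sum mulr_sumr; apply: eq_bigr => m _ /=.
  rewrite rmorphM /= rmorph_nat mulrCA; congr (_ * _).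
  rewrite big_split /= mdegE -prodrXr !natr_prod -prodfV -!big_split /=.
  apply: eq_bigr => i _; rewrite mnmBE (mnm_lepP le_as) mul1n -bin_ffact natrM.
  rewrite mulrACA mulrA divfK ?fact_rat_neq0 //; congr (_ * _); rewrite -{1}(subnK (mnm_lepP le_as i)).
  by rewrite addnCA exprD addnn -mul2n [X in _ * X]exprM sqrrN !expr1n mulr1.
(* A term other than that of alpha has a factor in which alpha i > gamma i, or in
   which binomial(0, gamma i - alpha i) = 0. *)
have [i ne_i] : exists i, alpha i != gamma i.
  apply/existsP; apply: contraNT ne_ga; rewrite negb_exists => /forallP eq_ag.
  by apply/eqP/val_inj/mnmP => i /=; apply/esym/eqP; have:= eq_ag i; rewrite negbK.
rewrite (bigD1 i) //= mnm0E bin0n subn_eq0.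
by case: ltngtP ne_i; rewrite ?mul0n ?muln0 ?mulr0 ?mul0r ?mulr0.
Qed.

Theorem theorem3p1 (S : comNzRingType) (S_artinian : artinian_ring S)
    (S_local : local_ring S) (r : nat) (s : 'X_{1..r})
    (I : idealType (mring S s)) (I_multihomog : multihomog_ideal I)
    (N : {mpoly int[r]})
    (hN : is_mseries_frac (hilbert_series I) N
            (\prod_(i < r) (1 - 'X_i) ^+ (s i).+1))
    (P : {mpoly rat[r]}) (hP : is_hilbert_polynomial I P)
    (c : 'X_{1..r} -> rat)
    (hc : P = \sum_(alpha : 'X_{1..r < (mdeg s).+1} | (alpha <= s)%MM)
                c alpha *: \prod_(i < r) binom_mpoly i (alpha i)) :
  forall alpha : 'X_{1..r}, (alpha <= s)%MM ->
    c alpha = (-1) ^+ mdeg (s - alpha)%MM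
              / (\prod_(i < r) (s i - alpha i)%N`!)%:R
              * (N^`M[s - alpha]).@[fun=> 1]%:~R.
Proof.
have [n0 P_hilbert] := hP.
by move=> alpha le_as; apply: binom_coefficient_of_frac hN P_hilbert hc le_as.
Qed.
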